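(* Let $k\in\mathbb{N}$, $k\geq 1$, let $f:{}^*\mathbb{R}\to{}^*\mathbb{R}$ be an internal function that is $k$-times mu-differentiable, with successive mu-derivatives $f',f'',\ldots,f^{(k)}$, and let $a\in\mathbb{R}$. If $$f'(a)\approx f''(a)\approx\cdots\approx f^{(k-1)}(a)\approx 0$$ and $f^{(k)}(a)\not\approx 0$, then (1) if $k$ is odd, then $a$ is not a local m-minimizer of $f$; (2) if $k$ is even and $f^{(k)}(a)\gg 0$, then $a$ is a local m-minimizer of $f$.
   Context: Setting: nonstandard analysis; ${}^*\mathbb{R}$ is the field of hyperreals (a nonstandard extension of $\mathbb{R}$ satisfying the Transfer Principle), with the usual notion of internal sets and functions. ${}^*]b,c[$ denotes the nonstandard extension of the open interval $]b,c[$. For $x,y\in{}^*\mathbb{R}$: $x\approx 0$ ($x$ is infinitesimal) means $|x|<r$ for all real $r>0$; $x\approx y$ means $x-y\approx 0$; $x$ is finite if $|x|<r$ for some real $r>0$; $x$ is nearstandard, $x\in ns({}^*\mathbb{R})$, if $x\approx b$ for some (unique) $b\in\mathbb{R}$. We write $x\gtrsim y$ if $x\ge y$ or $x\approx y$, and $x\gg y$ if $x>y$ and $x\not\approx y$. Mu-differentiability: an internal function $f:{}^*\mathbb{R}\to{}^*\mathbb{R}$ is mu-differentiable if $f(ns({}^*\mathbb{R}))\subseteq ns({}^*\mathbb{R})$ and there is an internal function $f':{}^*\mathbb{R}\to{}^*\mathbb{R}$ (a mu-derivative of $f$, in general not unique) such that (1) $f'(x)$ is finite whenever $x$ is nearstandard;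 (2) for each $b\in\mathbb{R}$ there is a positive infinitesimal $\delta_b$ such that for all $x,y\approx b$ with $|x-y|>\delta_b$ there is an infinitesimal $\eta$ with $f(x)-f(y)=f'(x)(x-y)+|x-y|\eta$. The function $f$ is $k$-times mu-differentiable if there are internal functions $f^{(0)}=f, f^{(1)}=f',\ldots,f^{(k)}$ such that, for $0\le j\le k-1$, $f^{(j)}$ is mu-differentiable with mu-derivative $f^{(j+1)}$. A point $a\in\mathbb{R}$ is a local m-minimizer of $f$ if there is a real $r>0$ such that $f(x)\gtrsim f(a)$ for all $x\in{}^*]a-r,a+r[$. For $k=1$ the displayed condition on the derivatives of order at most $k-1$ is empty. *)

(* Defs.v *)
From HB Require Import structures.
From mathcomp Require Import all_boot all_order all_algebra.
From mathcomp Require Import boolp classical_sets set_interval reals.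

Set Implicit Arguments.
Unset Strict Implicit.
Unset Printing Implicit Defensive.

Import Order.TTheory GRing.Theory Num.Theory.
Local Open Scope classical_set_scope.
Local Open Scope ring_scope.

(* The superstructure over a set of individuals is stratified by types:       *)
(* individuals, ordered pairs, and sets of entities of a given type.  [Pow t] *)
(* denotes ALL sets of entities of type [t], also over the hyperreals, where  *)
(* the internal ones are singled out by [internal] below.                     *)
Inductive etype := Ind | Pair of etype & etype | Pow of etype.

Fixpoint entity (T : Type) (t : etype) : Type :=
  match t with
  | Ind => T
  | Pair s t => (entity T s * entity T t)%type
  | Pow t => set (entity T t)
  end.

(* Typed de Bruijn syntax of the formulas with bounded quantifiers.  There    *)
(* are no constants: parameters are free variables valued by an environment.  *)
Inductive evar : seq etype -> etype -> Type :=
| EVar0 G t : evar (t :: G) t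
| EVarS G s t : evar G t -> evar (s :: G) t.

Inductive eterm (G : seq etype) : etype -> Type :=
| TVar t : evar G t -> eterm G t
| TPair s t : eterm G s -> eterm G t -> eterm G (Pair s t).

Inductive bformula : seq etype -> Type :=
| FEq G t : eterm G t -> eterm G t -> bformula G
| FMem G t : eterm G t -> eterm G (Pow t) -> bformula G
| FNot G : bformula G -> bformula G
| FAnd G : bformula G -> bformula G -> bformula G
| FOr G : bformula G -> bformula G -> bformula G
| FImp G : bformula G -> bformula G -> bformula G
| FAll G t : eterm G (Pow t) -> bformula (t :: G) -> bformula G
| FEx G t : eterm G (Pow t) -> bformula (t :: G) -> bformula G.

Fixpoint env (T : Type) (G : seq etype) : Type :=
  match G with
  | [::] => unit
  | t :: G' => (entity T t * env T G')%type
  end.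

Fixpoint eval_var (T : Type) G t (x : evar G t) : env T G -> entity T t :=
  match x with
  | EVar0 _ _ => fun e => e.1
  | EVarS _ _ _ y => fun e => eval_var y e.2
  end.

Fixpoint eval_term (T : Type) G t (e : env T G) (u : eterm G t) :
    entity T t :=
  match u with
  | TVar _ x => eval_var x e
  | TPair _ _ u v => (eval_term e u, eval_term e v)
  end.

Fixpoint sat (T : Type) G (phi : bformula G) : env T G -> Prop :=
  match phi with
  | FEq _ _ u v => fun e => eval_term e u = eval_term e v
  | FMem _ t u A => fun e => (eval_term e A : set (entity T t)) (eval_term e u)
  | FNot _ p => fun e => ~ sat p e
  | FAnd _ p q => fun e => sat p e /\ sat q e
  | FOr _ p q => fun e => sat p e \/ sat q e
  | FImp _ p q => fun e => sat p e -> sat q e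
  | FAll _ t A p => fun e => forall x : entity T t,
      (eval_term e A : set (entity T t)) x -> sat p ((x, e) : env T (t :: _))
  | FEx _ t A p => fun e => exists2 x : entity T t,
      (eval_term e A : set (entity T t)) x & sat p ((x, e) : env T (t :: _))
  end.

Fixpoint map_env (S T : Type) (h : forall t, entity S t -> entity T t) G :
    env S G -> env T G :=
  match G with
  | [::] => fun=> tt
  | t :: G' => fun e => (h t e.1, map_env h e.2)
  end.

Definition add_graph (K : realFieldType) :
    entity K (Pow (Pair (Pair Ind Ind) Ind)) :=
  [set p : K * K * K | p.1.1 + p.1.2 = p.2].

Definition mul_graph (K : realFieldType) :
    entity K (Pow (Pair (Pair Ind Ind) Ind)) :=
  [set p : K * K * K | p.1.1 * p.1.2 = p.2].

Definition le_graph (K : realFieldType) : entity K (Pow (Pair Ind Ind)) :=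
  [set p : K * K | p.1 <= p.2].

Arguments add_graph K : clear implicits.
Arguments mul_graph K : clear implicits.
Arguments le_graph K : clear implicits.

(* Requiring [hyper] to be an ordered field is no loss of generality: by      *)
(* transfer, the extensions of the operations and order of R make it one.     *)
Record nonstandard_extension (R : realType) := NonstandardExtension {
  hyper : realFieldType;
  star : forall t, entity R t -> entity hyper t;
  star_setT : star (t := Pow Ind) [set: R] = [set: hyper];
  star_add : star (t := Pow (Pair (Pair Ind Ind) Ind)) (add_graph R)
             = add_graph hyper;
  star_mul : star (t := Pow (Pair (Pair Ind Ind) Ind)) (mul_graph R)
             = mul_graph hyper;
  star_le : star (t := Pow (Pair Ind Ind)) (le_graph R) = le_graph hyper;
  transfer : forall G (phi : bformula G) (e : env R G),
    sat phi e <-> sat phi (map_env star e);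
  star_proper : exists x : hyper, forall r : R, x <> star (t := Ind) r
}.

Arguments star {R} E t _ : rename.

Definition std (R : realType) (E : nonstandard_extension R) (r : R) : hyper E :=
  star E Ind r.

Section Nonstandard.
Variables (R : realType) (E : nonstandard_extension R).
Implicit Types (x y : hyper E) (f g : hyper E -> hyper E).

Definition internal t (X : entity (hyper E) t) : Prop :=
  exists A : entity R (Pow t), (star E (Pow t) A : set _) X.

Definition internal_fun f : Prop :=
  @internal (Pow (Pair Ind Ind)) [set p | f p.1 = p.2].

Definition infinitesimal x : Prop := forall r : R, 0 < r -> `|x| < std E r.

Definition approx x y : Prop := infinitesimal (x - y).

Definition finite x : Prop := exists2 r : R, 0 < r & `|x| < std E r.

Definition nearstandard x : Prop := exists b : R, approx x (std E b).

Definition gtrsim x y : Prop := y <= x \/ approx x y.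

Definition much_greater x y : Prop := y < x /\ ~ approx x y.

Definition is_mu_derivative f f' : Prop :=
  [/\ internal_fun f',
      forall x, nearstandard x -> finite (f' x)
    & forall b : R, exists2 delta : hyper E, 0 < delta /\ infinitesimal delta &
        forall x y, approx x (std E b) -> approx y (std E b) ->
          delta < `|x - y| ->
          exists2 eta : hyper E, infinitesimal eta &
            f x - f y = f' x * (x - y) + `|x - y| * eta].

Definition mu_differentiable_with f f' : Prop :=
  [/\ internal_fun f,
      forall x, nearstandard x -> nearstandard (f x)
    & is_mu_derivative f f'].

(* [D j] is f^(j); only the values [D 0, ..., D k] are constrained. *)
Definition successive_mu_derivatives (k : nat) f
    (D : nat -> hyper E -> hyper E) : Prop :=
  D 0%N = f /\
  forall j : nat, (j < k)%N -> mu_differentiable_with (D j) (D j.+1).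

Definition local_m_minimizer f (a : R) : Prop :=
  exists2 r : R, 0 < r &
    forall x, (star E (Pow Ind) `]a - r, a + r[%classic : set (hyper E)) x ->
      gtrsim (f x) (f (std E a)).

End Nonstandard.

(* Main.v *)
Require Import Defs.
From HB Require Import structures.
From mathcomp Require Import all_boot all_order all_algebra.
From mathcomp Require Import boolp classical_sets set_interval reals.
From mathcomp Require Import ring lra.
From mathcomp Require Import topology normedtype derive.

Set Implicit Arguments.
Unset Strict Implicit.
Unset Printing Implicit Defensive.

Import Order.TTheory GRing.Theory Num.Theory.
Import numFieldNormedType.Exports.
Local Open Scope classical_set_scope.
Local Open Scope ring_scope.

(* Let g j be the standard part of f^(j), restricted to the reals.  The set   *)
(* of squared distances from b to the points farther than delta_b from b at   *)
(* which the linear approximation of f^(j) at b has relative error more than  *)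
(* a given real eps > 0 is internal and has no infinitesimal element.  By     *)
(* transfer it then has a positive real lower bound, so that g j is           *)
(* differentiable at b with derivative g (j + 1) b.  The classical k-th       *)
(* derivative test (descending induction on j, by the mean value theorem)     *)
(* settles the real points near a; since f x is infinitely close to f b       *)
(* whenever x is infinitely close to the real b, it also settles the          *)
(* hyperreal ones.                                                            *)

(* [#n] is the variable with de Bruijn index [n]; elaborating it requires the *)
(* context to be known, hence the bidirectionality hints.                     *)
Ltac nth_var n :=
  lazymatch n with
  | O => exact (EVar0 _ _)
  | S ?m => refine (EVarS _ _); nth_var m
  end.
Arguments TVar {G t} & _.
Arguments TPair {G s t} & _ _.
Arguments FEq {G t} & _ _.
Arguments FMem {G t} & _ _.
Arguments FNot {G} & _.
Arguments FAnd {G} & _ _.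
Arguments FImp {G} & _ _.
Arguments FAll {G t} & _ _.
Arguments FEx {G t} & _ _.
Local Notation "# n" := (TVar ltac:(let k := constr:(n%N) in nth_var k))
  (at level 2, n at level 1, only parsing).
Local Notation "a \in_ A" := (FMem a A) (at level 70, only parsing).
Local Notation "⟨ a , b ⟩" := (TPair a b) (only parsing).

(** The mu-derivative estimate controls only pairs farther apart than some infinitesimal, but
    distinct reals always are, so the standard parts of the successive mu-derivatives are genuine
    derivatives of one another ([mu_derivative_error], [successive_mu_derivatives_real]). Near a,
    the difference g 0 x - g 0 a then has the sign of g k a times (x - a)^k
    ([higher_derivative_sign]), which changes across a for k odd and is constant for k even.
    [gtrsim_approx] and [mu_differentiable_approx] carry this over to hyperreal values and
    points. *)

Section Std.
Variables (R : realType) (E : nonstandard_extension R).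

(** * Transfer and internal sets *)

Lemma star_mem t (A : entity R (Pow t)) (x : entity R t) :
  (star E (Pow t) A : set _) (star E t x) <-> (A : set _) x.
Proof.
have := @transfer _ E [:: t; Pow t] (#0 \in_ #1) (x, (A, tt)).
by case=> h1 h2; split.
Qed.

Lemma star_pair s t (x : entity R s) (y : entity R t) :
  star E (Pair s t) (x, y) = (star E s x, star E t y).
Proof.
have [h _] := @transfer _ E [:: Pair s t; s; t] (FEq #0 ⟨#1, #2⟩)
  ((x, y), (x, (y, tt))).
exact: h.
Qed.

Lemma stdD r s : std E (r + s) = std E r + std E s.
Proof.
have := (@star_mem (Pair (Pair Ind Ind) Ind) (add_graph R)
  (r, s, r + s)).2 erefl.
by rewrite star_add !star_pair /add_graph /= /std => <-.
Qed.

Lemma stdM r s : std E (r * s) = std E r * std E s.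
Proof.
have := (@star_mem (Pair (Pair Ind Ind) Ind) (mul_graph R)
  (r, s, r * s)).2 erefl.
by rewrite star_mul !star_pair /mul_graph /= /std => <-.
Qed.

Lemma std_le r s : (std E r <= std E s) = (r <= s).
Proof.
have := @star_mem (Pair Ind Ind) (le_graph R) (r, s).
rewrite star_le star_pair /le_graph /= -/(std E r) -/(std E s) => h.
by apply/idP/idP => /h.
Qed.


Lemma std_lt r s : (std E r < std E s) = (r < s).
Proof. by rewrite !ltNge std_le. Qed.

Lemma star_itv (l u : R) (x : hyper E) :
  (star E (Pow Ind) `]l, u[%classic : set _) x -> std E l < x < std E u.
Proof.
pose phi : bformula [:: Pow Ind; Ind; Ind; Pow (Pair Ind Ind)] :=
  FAll #0 (FAnd (FNot (⟨#0, #2⟩ \in_ #4)) (FNot (⟨#3, #0⟩ \in_ #4))).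
have [h _] := transfer E phi (`]l, u[%classic, (l, (u, (le_graph R, tt)))).
have /h : sat phi (`]l, u[%classic, (l, (u, (le_graph R, tt)))).
  rewrite /phi /= => y; rewrite in_itv /= => /andP[ly yu].
  by split; apply/negP; rewrite -ltNge.
rewrite /phi /= star_le => {}h /h [/negP + /negP].
by rewrite /= -!ltNge => -> ->.
Qed.

(** Transfer of the existence of infima: an infimum bounded below by l > 0 is approached within l,
    and both the infimum and l are at most y, whence the factor 2. *)
Lemma internal_almost_min (V : set (hyper E)) (l : hyper E) (v : hyper E) :
    internal (t := Pow Ind) V -> 0 < l -> (forall x, V x -> l <= x) -> V v ->
  exists2 x, V x & forall y, V y -> x <= y + y.
Proof.
move=> [A AV] l0 lV Vv.
pose phi : bformula [:: Pow (Pow Ind); Pow Ind;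
    Pow (Pair (Pair Ind Ind) Ind); Pow (Pair Ind Ind)] :=
  FAll #0 (FAll #2
    (* Positivity of the bound m is written as: m + m is not at most m. *)
    (FImp (FAll #3 (FImp (⟨⟨#1, #1⟩, #0⟩ \in_ #5)
                          (FNot (⟨#0, #1⟩ \in_ #6))))
    (FImp (FAll #1 (⟨#1, #0⟩ \in_ #6))
    (FAll #1 (FEx #2 (FAll #3 (FAll #6 (FImp (⟨⟨#1, #1⟩, #0⟩ \in_ #8)
       (⟨#2, #0⟩ \in_ #9))))))))).
have [h _] := transfer E phi (A, (setT, (add_graph R, (le_graph R, tt)))).
have /h : sat phi (A, (setT, (add_graph R, (le_graph R, tt)))).
  rewrite /phi /= => W _ m _ m2 mW w Ww.
  have m0 : 0 < m.
    by have /negP := m2 (m + m) I erefl; rewrite /le_graph /= -ltNge ltrDl.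
  have infW : has_inf W by split; [exists w | exists m => x /mW].
  have mi : m <= inf W by apply: lb_le_inf; [exists w | move=> x /mW].
  have [x Wx xi] := inf_adherent m0 infW.
  exists x => // y Wy z _; rewrite /add_graph /le_graph /= => <-.
  apply: le_trans (ltW xi) _; apply: lerD.
    by apply: ge_inf => //; exists m => ? /mW.
  exact: mW.
rewrite /phi /= star_setT star_add star_le => /(_ V AV l I) {}h.
have {}h : exists2 x, V x & forall y, V y -> forall z, True ->
    add_graph _ (y, y, z) -> le_graph _ (x, z).
  apply: (h _ _ v Vv) => [z _|]; last exact: lV.
  rewrite /add_graph /le_graph /= => <-.
  by apply/negP; rewrite /= -ltNge ltrDl.
by case: h => x Vx hx; exists x => // y Vy; apply: (hx y Vy _ I).
Qed.

(** Internal definition principle for one formula, by transfer of comprehension over the reals.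
    Distances and errors are squared so that sum, product and order suffice to express them. *)
Lemma internal_bad_set (f : hyper E -> hyper E) (b p m e d : hyper E) :
    internal_fun f ->
  internal (t := Pow Ind) [set s | exists y, [/\ s = (y - b) ^+ 2, d < s &
    e * s < (f y - (m * (y - b) + p)) ^+ 2]].
Proof.
move=> [A Af].
(* Inside the eight existentials the indices stand for                        *)
(*   0: e s, 1: r^2, 2: r, 3: m t + p, 4: m t, 5: f y, 6: t = y - b, 7: y,    *)
(*   8: s, 9: the set being defined, 10: d, 11: e, 12: m, 13: p, 14: b,       *)
(*   15: the graph of f, 16: A, 17, 18: the full sets, 19: +, 20: *, 21: <=.  *)
pose bad : bformula [:: Ind; Pow Ind; Ind; Ind; Ind; Ind; Ind;
    Pow (Pair Ind Ind); Pow (Pow (Pair Ind Ind)); Pow (Pow Ind); Pow Ind;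
    Pow (Pair (Pair Ind Ind) Ind); Pow (Pair (Pair Ind Ind) Ind);
    Pow (Pair Ind Ind)] :=
  FEx #10 (FEx #11 (FEx #12 (FEx #13 (FEx #14 (FEx #15 (FEx #16 (FEx #17
    (FAnd (⟨⟨#6, #14⟩, #7⟩ \in_ #19)
    (FAnd (⟨⟨#6, #6⟩, #8⟩ \in_ #20)
    (FAnd (⟨#7, #5⟩ \in_ #15)
    (FAnd (⟨⟨#12, #6⟩, #4⟩ \in_ #20)
    (FAnd (⟨⟨#4, #13⟩, #3⟩ \in_ #19)
    (FAnd (⟨⟨#2, #3⟩, #5⟩ \in_ #19)
    (FAnd (⟨⟨#2, #2⟩, #1⟩ \in_ #20)
    (FAnd (⟨⟨#11, #8⟩, #0⟩ \in_ #20)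
    (FAnd (FNot (⟨#8, #10⟩ \in_ #21))
          (FNot (⟨#1, #0⟩ \in_ #21)))))))))))))))))).
pose phi : bformula [:: Pow (Pow (Pair Ind Ind)); Pow (Pow Ind); Pow Ind;
    Pow (Pair (Pair Ind Ind) Ind); Pow (Pair (Pair Ind Ind) Ind);
    Pow (Pair Ind Ind)] :=
  FAll #0 (FAll #3 (FAll #4 (FAll #5 (FAll #6 (FAll #7 (FEx #7 (FAll #9
    (FAnd (FImp (#0 \in_ #1) bad) (FImp bad (#0 \in_ #1)))))))))).
pose e0 : env R [:: Pow (Pow (Pair Ind Ind)); Pow (Pow Ind); Pow Ind;
    Pow (Pair (Pair Ind Ind) Ind); Pow (Pair (Pair Ind Ind) Ind);
    Pow (Pair Ind Ind)] :=
  (A, (setT, (setT, (add_graph R, (mul_graph R, (le_graph R, tt)))))).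
have [h _] := transfer E phi e0.
have /h : sat phi e0.
  move=> F _ b' _ p' _ m' _ e' _ d' _.
  (* [set0] is a default value for the slot of the set being defined. *)
  by exists [set s |
    sat bad (s, (set0, (d', (e', (m', (p', (b', (F, e0))))))))].
move=> /(_ _ Af b) {}h.
move: h; rewrite /= star_setT star_add star_mul star_le.
move=> /(_ I p I m I e I d I) [V VR hV].
exists setT; rewrite (_ : [set _ | _] = V) //.
apply/seteqP; split=> s.
  case=> y [sE ds es]; apply: (hV s I).2.
  exists y => //; exists (y - b) => //; exists (f y) => //.
  exists (m * (y - b)) => //; exists (m * (y - b) + p) => //.
  exists (f y - (m * (y - b) + p)) => //.
  exists ((f y - (m * (y - b) + p)) ^+ 2) => //; exists (e * s) => //.
  rewrite /add_graph /mul_graph /le_graph /= !subrK -!expr2 sE.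
  by do ?split => //; apply/negP; rewrite -ltNge // -sE.
move=> /(hV s I).1 [y _ [t _ [v _ [n _ [q _ [r _ [r2 _ [es _]]]]]]]].
rewrite /add_graph /mul_graph /le_graph /=.
move=> [yE [sE [<- [nE [qE [rE [r2E [esE [/negP + /negP]]]]]]]]].
rewrite -!ltNge => ds err; exists y.
have tE : y - b = t by rewrite -yE addrK.
have -> : f y - (m * (y - b) + p) = r by rewrite tE nE qE -rE addrK.
by rewrite tE !expr2 r2E sE esE.
Qed.

End Std.

(** * Infinitesimals and standard parts *)

Section Infinitesimals.
Variables (R : realType) (E : nonstandard_extension R).
Implicit Types (x y z : hyper E) (r s p q : R).

Lemma ler_sqr_norm (K : realDomainType) (u v : K) :
  (u ^+ 2 <= v ^+ 2) = (`|u| <= `|v|).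
Proof.
rewrite -(real_normK (num_real u)) -(real_normK (num_real v)).
by rewrite ler_sqr ?nnegrE.
Qed.

Lemma ltr_sqr_norm (K : realDomainType) (u v : K) :
  (u ^+ 2 < v ^+ 2) = (`|u| < `|v|).
Proof. by rewrite !ltNge ler_sqr_norm. Qed.

Lemma std0 : std E 0 = 0.
Proof. by apply: (addrI (std E 0)); rewrite -stdD !addr0. Qed.

Lemma stdN r : std E (- r) = - std E r.
Proof. by apply: (addrI (std E r)); rewrite -stdD !subrr std0. Qed.

Lemma stdB r s : std E (r - s) = std E r - std E s.
Proof. by rewrite stdD stdN. Qed.

Lemma std_gt0 r : (0 < std E r) = (0 < r).
Proof. by rewrite -std0 std_lt. Qed.

Lemma std_norm r : std E `|r| = `|std E r|.
Proof.
have [r0|r0] := leP 0 r; first by rewrite !ger0_norm // -std0 std_le.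
by rewrite !ltr0_norm ?stdN // -std0 std_lt.
Qed.

Lemma infinitesimal_le x y : `|x| <= `|y| -> infinitesimal y -> infinitesimal x.
Proof. by move=> xy iy r r0; apply: le_lt_trans xy (iy r r0). Qed.

Lemma infinitesimalD x y :
  infinitesimal x -> infinitesimal y -> infinitesimal (x + y).
Proof.
move=> ix iy r r0; have r2 : 0 < r / 2 by lra.
rewrite [r]splitr stdD; apply: le_lt_trans (ler_normD _ _) _.
by apply: ltrD; [apply: ix | apply: iy].
Qed.

Lemma infinitesimalN x : infinitesimal x -> infinitesimal (- x).
Proof. by apply: infinitesimal_le; rewrite normrN. Qed.

Lemma infinitesimalM x y :
  finite x -> infinitesimal y -> infinitesimal (x * y).
Proof.
move=> [c c0 xc] iy r r0; rewrite normrM -[r](divfK (lt0r_neq0 c0)) mulrC stdM.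
by apply: ltr_pM => //; apply: iy; rewrite divr_gt0.
Qed.

Lemma infinitesimal_finite x : infinitesimal x -> finite x.
Proof. by move=> ix; exists 1 => //; apply: ix. Qed.

Lemma approx_refl x : approx x x.
Proof. by rewrite /approx subrr => r r0; rewrite normr0 std_gt0. Qed.

Lemma approx_sym x y : approx x y -> approx y x.
Proof. by move/infinitesimalN; rewrite opprB. Qed.

Lemma approx_trans x y z : approx x y -> approx y z -> approx x z.
Proof. by move=> xy /(infinitesimalD xy); rewrite subrKA. Qed.

Lemma approxB x y x' y' :
  approx x x' -> approx y y' -> approx (x - y) (x' - y').
Proof.
move=> ix /infinitesimalN /(infinitesimalD ix); rewrite /approx.
by congr infinitesimal; ring.
Qed.

Lemma approx_norm x y : approx x y -> approx `|x| `|y|.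
Proof. exact/infinitesimal_le/ler_dist_dist. Qed.

Lemma approx_le x y p q :
  approx x (std E p) -> approx y (std E q) -> x <= y -> p <= q.
Proof.
move=> xp yq xy; rewrite leNgt; apply/negP => qp.
have e0 : 0 < (p - q) / 2 by lra.
have := xp _ e0; have := yq _ e0; have := stdB p q.
rewrite {1}[p - q]splitr stdD; set e := std E (_ / 2).
by rewrite !ltr_norml => ? /andP[? ?] /andP[? ?]; lra.
Qed.

Lemma finite_std r : finite (std E r).
Proof.
exists (`|r| + 1); first by rewrite ltr_wpDl.
by rewrite -std_norm std_lt ltrDl.
Qed.

(** By completeness of the reals: the standard part is the supremum of the reals below x. *)
Lemma finite_nearstandard x : finite x -> nearstandard x.
Proof.
move=> [c c0]; rewrite ltr_norml => /andP[cx xc].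
pose S : set R := [set s | std E s <= x].
have supS : has_sup S.
  split; first by exists (- c); rewrite /S /= stdN ltW.
  by exists c => s /= sx; rewrite -(std_le E) (le_trans sx) ?ltW.
exists (sup S) => r r0; rewrite ltr_norml; apply/andP; split.
  have [s sx rs] := sup_adherent r0 supS.
  move: sx rs; rewrite /S /= -(std_lt E) stdB => sx rs; lra.
rewrite ltrBlDl -stdD ltNge; apply/negP => h.
by have := sup_upper_bound supS h; lra.
Qed.

Lemma not_infinitesimal x :
  ~ infinitesimal x -> exists2 r, 0 < r & std E r <= `|x|.
Proof.
move=> /existsNP[r /not_implyP[r0 /negP]]; rewrite -leNgt => rx.
by exists r.
Qed.

(** Reduces m-minimality to a comparison of real numbers. *)
Lemma gtrsim_approx x y p q : approx x (std E p) -> approx y (std E q) ->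
  gtrsim x y <-> q <= p.
Proof.
move=> xp yq; split=> [[yx|xy]|qp]; first exact: approx_le yx.
  have pq := approx_trans (approx_sym xy) xp.
  exact: approx_le yq pq (lexx y).
have [yx|xy] := leP y x; [by left | right].
suff pq : p = q by rewrite pq in xp; apply: approx_trans xp (approx_sym yq).
by apply/le_anti; rewrite qp (approx_le xp yq (ltW xy)).
Qed.

End Infinitesimals.

(** * Consequences of mu-differentiability at a real point *)

Section MuDerivative.
Variables (R : realType) (E : nonstandard_extension R).
Variables (f f' : hyper E -> hyper E) (b : R).
Hypotheses (fi : internal_fun f) (ff' : is_mu_derivative f f').

Lemma mu_differentiable_approx x :
  approx x (std E b) -> approx (f x) (f (std E b)).
Proof.
case: ff' => _ fin /(_ b)[d [d0 id] hd] xb.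
have far y z : approx y (std E b) -> approx z (std E b) -> d < `|y - z| ->
    approx (f y) (f z).
  move=> yb zb dyz; rewrite /approx; have [e ie ->] := hd y z yb zb dyz.
  have yz : infinitesimal (y - z) by exact: approx_trans yb (approx_sym zb).
  apply: infinitesimalD; apply: infinitesimalM => //.
    by apply: fin; exists b.
  by apply: infinitesimal_finite; apply: infinitesimal_le yz; rewrite normr_id.
have [dx|xd] := ltP d `|x - std E b|; first exact: far (approx_refl _) dx.
(* When x is within d of b, compare both with b + 3d, which is at least 2d from x and 3d from b. *)
pose z := std E b + (d + d + d).
have zb : approx z (std E b).
  by rewrite /approx /z addrC addKr; do !apply: infinitesimalD.
have zE : z - std E b = d + d + d by rewrite /z addrC addKr.
apply: approx_trans (far x z xb zb _) (far z _ zb (approx_refl _) _).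
  move: xd; rewrite ler_norml distrC => /andP[? ?].
  apply: lt_le_trans _ (ler_norm _); lra.
by apply: lt_le_trans _ (ler_norm _); lra.
Qed.

Lemma mu_derivative_error (e : R) : 0 < e ->
  exists2 r : R, 0 < r & forall y, `|y - b| < r ->
    `|f (std E y) - f (std E b) - f' (std E b) * (std E y - std E b)|
      <= std E (e * `|y - b|).
Proof.
move=> e0; case: ff' => _ _ /(_ b)[d [d0 id] hd].
set B := std E b; set m := f' B; set p := f B.
pose err y := f y - (m * (y - B) + p).
pose bad : set (hyper E) := [set s | exists y, [/\ s = (y - B) ^+ 2, d ^+ 2 < s
    & (std E e) ^+ 2 * s < err y ^+ 2]].
(* At an infinitesimal distance exceeding d, the relative error is infinitesimal, hence below e. *)
have bad_far y : d ^+ 2 < (y - B) ^+ 2 ->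
    std E e ^+ 2 * (y - B) ^+ 2 < err y ^+ 2 -> ~ infinitesimal (y - B).
  rewrite -exprMn !ltr_sqr_norm (gtr0_norm d0) => dy erry yB.
  have [|n nn fE] := hd B y (approx_refl _) yB; first by rewrite distrC.
  rewrite distrC in fE.
  have errE : err y = - (`|y - B| * n).
    by rewrite /err -/p -[f y](subKr (f B)) fE -/m -/p; ring.
  move: erry; rewrite errE normrN !normrM normr_id mulrC.
  have yB0 : 0 < `|y - B| by exact: lt_trans dy.
  rewrite ltr_pM2l // -std_norm (gtr0_norm e0) => en.
  by have := lt_trans en (nn e e0); rewrite ltxx.
have [r r0 hr] : exists2 r : R, 0 < r & forall s, bad s -> (std E r) ^+ 2 <= s.
  have [[v bv]|nobad] := pselect (exists v, bad v); last first.
    by exists 1 => // s bs; case: nobad; exists s.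
  have [s [y [sE ds es]] smin] := internal_almost_min
    (internal_bad_set _ _ _ _ _ fi) (exprn_gt0 2 d0)
    (fun s '(ex_intro _ (And3 _ ds _)) => ltW ds) bv.
  have [r r0 ry] : exists2 r, 0 < r & std E r <= `|y - B|.
    by apply/not_infinitesimal/bad_far; rewrite -sE.
  (* Every bad t satisfies r^2 <= s <= 2t, so (r/2)^2 <= t. *)
  exists (r / 2); first lra.
  move=> t /smin st.
  have : std E r ^+ 2 <= s.
    by rewrite sE ler_sqr_norm -std_norm gtr0_norm.
  have -> : std E r = std E (r / 2) + std E (r / 2).
    by rewrite -stdD -splitr.
  by nra.
exists r => // y yr; rewrite leNgt; apply/negP => bady.
have yb : y != b.
  apply/eqP => yb; move: bady.
  by rewrite yb !subrr mulr0 subrr !normr0 mulr0 std0 ltxx.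
suff /hr : bad ((std E y - B) ^+ 2).
  by rewrite ler_sqr_norm /B -stdB -!std_norm std_le (gtr0_norm r0) leNgt yr.
exists (std E y); split => //.
  (* A nonzero real distance exceeds the infinitesimal d. *)
  rewrite ltr_sqr_norm /B -stdB -std_norm; apply: id.
  by rewrite normr_gt0 subr_eq0.
rewrite -exprMn ltr_sqr_norm normrM /B -stdB -!std_norm (gtr0_norm e0) -stdM.
by apply: lt_le_trans bady _; rewrite /err opprD addrA addrAC.
Qed.

End MuDerivative.

(** * The classical higher derivative test *)

Section HigherDerivativeTest.
Variable R : realType.

(** This division-free form, with a non-strict bound, survives taking standard parts. *)
Lemma is_derive1_littleo (g : R -> R) (b m : R) : is_derive b 1 g m <->
  forall e : R, 0 < e -> exists2 r : R, 0 < r & forall y, `|y - b| < r ->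
    `|g y - g b - m * (y - b)| <= e * `|y - b|.
Proof.
pose q h := h^-1 *: ((g \o shift b) (h *: 1) - g b).
have qE y : y != b ->
    `|g y - g b - m * (y - b)| = `|m - q (y - b)| * `|y - b|.
  move=> yb; rewrite -normrM distrC; congr `|_|.
  rewrite /q /= !scaler1 /shift /= subrK /GRing.scale /=; field.
  by rewrite subr_eq0.
split=> [[dg gm] e e0|small].
  have : q h @[h --> 0^'] --> m by rewrite -gm.
  move=> /cvgrPdist_le/(_ e e0); rewrite near_withinE.
  move=> /nbhs_ballP[r /= r0 hr]; exists r => // y yr.
  have [->|yb] := eqVneq y b; first by rewrite !subrr mulr0 subrr !normr0 mulr0.
  rewrite qE // ler_wpM2r //; apply: hr; rewrite ?subr_eq0 //.
  by rewrite /ball /= sub0r normrN.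
have qm : q h @[h --> 0^'] --> m.
  apply/cvgrPdist_le => e e0; have [r r0 hr] := small e e0.
  near=> h; have h0 : h != 0 by near: h; exact: nbhs_dnbhs_neq.
  have hb : h + b != b by rewrite -subr_eq0 addrK.
  have := hr (h + b); rewrite qE // addrK => {}hr.
  rewrite -(ler_pM2r (_ : 0 < `|h|)) ?normr_gt0 //; apply: hr.
  by near: h; exact: dnbhs0_lt.
apply: DeriveDef; last exact: cvg_lim.
by apply/cvg_ex; exists m.
Unshelve. all: by end_near. Qed.

(** The product with (x - a)^(k+1) treats both parities and both sides of a at once, and is what the
    induction through the mean value theorem preserves. *)
Lemma higher_derivative_sign (k : nat) (g : nat -> R -> R) (a : R) :
    (forall (j : nat) (x : R), (j <= k)%N -> is_derive x 1 (g j) (g j.+1 x)) ->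
    (forall j, (1 <= j <= k)%N -> g j a = 0) -> 0 < g k.+1 a ->
  exists2 r, 0 < r & forall x, 0 < `|x - a| < r ->
    0 < (g 0%N x - g 0%N a) * (x - a) ^+ k.+1.
Proof.
elim: k g => [|k IH] g dg g0 ga.
  (* An error of at most half the slope m leaves v u >= (m/2) u^2 > 0. *)
  have [|r r0 hr] := (is_derive1_littleo _ _ _).1 (dg 0%N a isT)
    (g 1%N a / 2).
    by rewrite divr_gt0.
  exists r => // x /andP[xa xr]; rewrite expr1.
  have := hr x xr.
  have : 0 < (x - a) ^+ 2 by rewrite exprn_even_gt0 // -normr_gt0.
  set u := x - a; set v := g 0%N x - g 0%N a; set m := g 1%N a in ga *.
  move=> u2; have [u0|u0] := leP 0 u.
    by rewrite (ger0_norm u0) ler_norml => /andP[? ?]; nra.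
  by rewrite (ltr0_norm u0) ler_norml => /andP[? ?]; nra.
have [|||r r0 hr] := IH (fun j => g j.+1).
- by move=> j x jk; exact: dg.
- by move=> j /andP[_ jk]; exact: g0.
- exact: ga.
exists r => // x /andP[xa xr].
have cont u v : {within `[u, v], continuous (g 0%N)}.
  by apply: derivable_within_continuous => y _; case: (dg 0%N y isT).
(* The ratio t in ]0, 1[ records that c lies on the same side of a as x, and closer. *)
have [c [t /andP[t0 t1] ct] gx] : exists2 c, exists2 t, 0 < t < 1 &
    c - a = t * (x - a) & g 0%N x - g 0%N a = g 1%N c * (x - a).
  have [ax|ax|xE] := ltgtP x a; last by rewrite xE subrr normr0 ltxx in xa.
    have [c + gx] := MVT ax (fun y _ => dg 0%N y isT) (cont _ _).
    rewrite in_itv /= => /andP[xc ca]; exists c; last by lra.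
    exists ((c - a) / (x - a)); last by rewrite divfK //; lra.
    apply/andP; split; first by rewrite nmulr_lgt0 ?invr_lt0; lra.
    by rewrite ltr_ndivrMr; lra.
  have [c + gx] := MVT ax (fun y _ => dg 0%N y isT) (cont _ _).
  rewrite in_itv /= => /andP[ac cx]; exists c => //.
  exists ((c - a) / (x - a)); last by rewrite divfK //; lra.
  by apply/andP; split; [rewrite divr_gt0; lra | rewrite ltr_pdivrMr; lra].
have /hr : 0 < `|c - a| < r.
  rewrite ct normrM (gtr0_norm t0) mulr_gt0 //=.
  by apply: le_lt_trans xr; rewrite ler_piMl // ltW.
rewrite (g0 1%N isT) subr0 ct exprMn mulrCA pmulr_rgt0 ?exprn_gt0 // => pos.
rewrite gx [_ ^+ k.+2]exprS.
have -> : g 1%N c * (x - a) * ((x - a) * (x - a) ^+ k.+1) =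
   (x - a) ^+ 2 * (g 1%N c * (x - a) ^+ k.+1) by ring.
by rewrite mulr_gt0 // exprn_even_gt0 // -normr_gt0.
Qed.

End HigherDerivativeTest.

(** * Real derivatives from mu-derivatives *)

Section StandardPart.
Variables (R : realType) (E : nonstandard_extension R).

Lemma successive_mu_derivatives_real (k : nat) (f : hyper E -> hyper E)
    (D : nat -> hyper E -> hyper E) : (1 <= k)%N ->
    successive_mu_derivatives k f D ->
  exists2 g : nat -> R -> R,
    forall j x, (j <= k)%N -> approx (D j (std E x)) (std E (g j x))
  & forall (j : nat) (x : R), (j < k)%N -> is_derive x 1 (g j) (g j.+1 x).
Proof.
case: k => // k _ [_ hD].
have ns j x : (j <= k.+1)%N -> nearstandard (D j (std E x)).
  have nsx : nearstandard (std E x) by exists x; exact: approx_refl.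
  rewrite leq_eqVlt => /predU1P[->|/hD[_ + _]]; last exact.
  (* The last derivative is known only as a mu-derivative, hence finite at nearstandard points. *)
  by have [_ _ [_ fin _]] := hD k (ltnSn k); apply/finite_nearstandard/fin.
(* Beyond the top order the value defaults to 0. *)
have st j x : {c | (j <= k.+1)%N -> approx (D j (std E x)) (std E c)}.
  apply: cid; have [jk|jk] := pselect (j <= k.+1)%N; last by exists 0.
  by have [c] := ns j x jk; exists c.
pose g j x := projT1 (st j x).
have gP j x : (j <= k.+1)%N -> approx (D j (std E x)) (std E (g j x)).
  exact: projT2 (st j x).
exists g => //.
move=> j x jk; apply/is_derive1_littleo => e e0.
have [Di _ dD] := hD j jk.
have [r r0 hr] := mu_derivative_error x Di dD e0.
exists r => // y /hr le_err.
apply: approx_le le_err; last exact: approx_refl.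
rewrite std_norm; apply: approx_norm; rewrite !stdB stdM stdB.
apply: approxB; first by apply: approxB; apply: gP; exact: ltnW.
rewrite /approx -mulrBl mulrC; apply: infinitesimalM.
  by rewrite -stdB; exact: finite_std.
exact: gP.
Qed.

End StandardPart.

(** * The test for hyperreal functions *)

Theorem mainTheorem5 (R : realType) (E : nonstandard_extension R) (k : nat)
    (f : hyper E -> hyper E) (D : nat -> hyper E -> hyper E) (a : R)
    (k_ge1 : (1 <= k)%N)
    (fD : successive_mu_derivatives k f D)
    (Dlt : forall j : nat, (1 <= j <= k - 1)%N -> approx (D j (std E a)) 0)
    (Dk : ~ approx (D k (std E a)) 0) :
  (odd k -> ~ local_m_minimizer f a) /\
  (~~ odd k -> much_greater (D k (std E a)) 0 -> local_m_minimizer f a).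
Proof.
have [g gD dg] := successive_mu_derivatives_real k_ge1 fD.
case: fD => D0 hD.
(* From here the order is k.+1, so [oddk] and [evenk] refer to the parity of k.+1. *)
case: k k_ge1 Dlt Dk gD dg hD => // k _; rewrite subn1 /= => Dlt Dk gD dg hD.
have g0 j : (1 <= j <= k)%N -> g j a = 0.
  move=> /[dup] /andP[_ jk] /Dlt Dj0; have Djg := gD j a (leqW jk).
  rewrite -(std0 E) in Dj0; apply/le_anti.
  by rewrite (approx_le Djg Dj0) ?(approx_le Dj0 Djg).
have gk0 : g k.+1 a != 0.
  by apply/eqP => gk; have := gD k.+1 a (leqnn _); rewrite gk std0.
have fg x : approx (f (std E x)) (std E (g 0%N x)) by rewrite -D0; exact: gD.
split=> [oddk [r r0 fmin]|evenk [Dk0 _]].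
  suff [x xr gx] : exists2 x, `|x - a| < r & g 0%N x < g 0%N a.
    have /fmin : (star E (Pow Ind) `]a - r, a + r[%classic : set _) (std E x).
      by apply/star_mem; rewrite /= in_itv /= -ltr_distl.
    by move/(gtrsim_approx (fg x) (fg a)); rewrite leNgt gx.
  have near0 s : 0 < s -> exists2 t, 0 < t & (t < r) && (t < s).
    by move=> s0; exists (Num.min r s / 2); case: (ltP r s) => ?; lra.
  (* The function decreases in value to the left of a if the top derivative is positive, and to the
     right (by the test for - g) if it is negative. *)
  have [gk|gk|/esym/eqP] := ltgtP 0 (g k.+1 a); last by rewrite (negPf gk0).
    have [s s0 hs] := higher_derivative_sign dg g0 gk.
    have [t t0 /andP[tr ts]] := near0 s s0.
    have ta : `|a - t - a| = t by rewrite addrAC subrr add0r normrN gtr0_norm.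
    exists (a - t); rewrite ?ta //.
    have := hs (a - t); rewrite ta t0 ts => /(_ isT).
    rewrite addrAC subrr add0r nmulr_lgt0 ?subr_lt0 //.
    by rewrite exprn_odd_lt0 ?oppr_lt0.
  have [||| s s0 hs] := @higher_derivative_sign _ k (fun j x => - g j x) a.
  - by move=> j x jk; apply: is_deriveN; exact: dg.
  - by move=> j jk; rewrite g0 ?oppr0.
  - by rewrite oppr_gt0.
  have [t t0 /andP[tr ts]] := near0 s s0.
  have ta : `|a + t - a| = t by rewrite addrAC subrr add0r gtr0_norm.
  exists (a + t); rewrite ?ta //.
  have := hs (a + t); rewrite ta t0 ts => /(_ isT).
  rewrite addrAC subrr add0r pmulr_lgt0 ?exprn_gt0 //.
  by rewrite -opprD oppr_gt0 subr_lt0.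
have gk : 0 < g k.+1 a.
  rewrite lt_neqAle eq_sym gk0 /=.
  apply: (approx_le _ (gD k.+1 a (leqnn _)) (ltW Dk0)).
  by rewrite std0; exact: approx_refl.
have [s s0 hs] := higher_derivative_sign dg g0 gk.
(* The standard part b of x lies only in the closed interval; halving s keeps it strictly within s
   of a. *)
exists (s / 2); first lra.
move=> x /star_itv /andP[lx xu].
have [b xb] : nearstandard x.
  apply: finite_nearstandard; exists (`|a - s / 2| + `|a + s / 2| + 1).
    by rewrite ltr_wpDl // addr_ge0.
  rewrite ltr_norml -stdN; apply/andP; split.
    apply: le_lt_trans lx; rewrite std_le.
    have := ler_norm (- (a - s / 2)); rewrite normrN.
    by have := normr_ge0 (a + s / 2); lra.
  apply: lt_trans xu _; rewrite std_lt.
  by have := ler_norm (a + s / 2); have := normr_ge0 (a - s / 2); lra.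
have lb : a - s / 2 <= b.
  by apply: (approx_le _ xb (ltW lx)); exact: approx_refl.
have bu : b <= a + s / 2.
  by apply: (approx_le xb _ (ltW xu)); exact: approx_refl.
have fxb : approx (f x) (std E (g 0%N b)).
  have [Di _ dD] := hD 0%N isT; rewrite D0 in dD.
  exact: approx_trans (mu_differentiable_approx dD xb) (fg b).
apply/(gtrsim_approx fxb (fg a)).
have [->//|ba] := eqVneq b a.
have /hs : 0 < `|b - a| < s.
  by rewrite normr_gt0 subr_eq0 ba /= ltr_norml; apply/andP; split; lra.
rewrite pmulr_lgt0 ?subr_gt0 => [/ltW|]//.
by rewrite exprn_even_gt0 // subr_eq0 ba orbT.
Qed.
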